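(* Let $\mathcal{A}$ be an abelian monoidal category with biexact tensor product and let $\mathcal{C}$ be a two-sided Serre tensor-ideal of $\mathcal{A}$. Then the quotient category $\mathcal{A}/\mathcal{C}$, equipped with the tensor product, associativity constraint and unit isomorphisms induced from $\mathcal{A}$ (as defined in the context), is a monoidal category.
   Context: A Serre subcategory of an abelian category $\mathcal{A}$ is a full additive subcategory closed under subobjects, quotients and extensions. The quotient category $\mathcal{A}/\mathcal{C}$ has the same objects as $\mathcal{A}$, and $\mathrm{Hom}_{\mathcal{A}/\mathcal{C}}(M,N)=\varinjlim_{M',N'}\mathrm{Hom}_{\mathcal{A}}(M',N/N')$, where $M'\subset M$ and $N'\subset N$ run over the subobjects with $M/M'\in\mathcal{C}$ and $N'\in\mathcal{C}$; $T:\mathcal{A}\to\mathcal{A}/\mathcal{C}$ is the canonical functor. For $f:M'\to N/N'$ in this direct system, the morphism $M\to N$ of $\mathcal{A}/\mathcal{C}$ represented by $f$ is also written $Tf$; every morphism of $\mathcal{A}/\mathcal{C}$ is of this form. A two-sided Serre tensor-ideal of an abelian monoidal category $\mathcal{A}$ is a Serre subcategory $\mathcal{C}$ such that $X\otimes Y\in\mathcal{C}$ and $Y\otimes X\in\mathcal{C}$ for all $X\in\mathcal{A}$, $Y\in\mathcal{C}$. Monoidal structure on $\mathcal{A}/\mathcal{C}$: the tensor product of objects is that of $\mathcal{A}$, and the unit object is that of $\mathcal{A}$. If $\bar f=Tf:M\to N$ and $\bar g=Tg:X\to Y$ are morphisms of $\mathcal{A}/\mathcal{C}$, represented by $f:M'\to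 N/N'$ and $g:X'\to Y/Y'$, then $\bar f\otimes\bar g:=T(f\otimes g):M\otimes X\to N\otimes Y$ is the morphism of $\mathcal{A}/\mathcal{C}$ represented by $f\otimes g:M'\otimes X'\to (N/N')\otimes(Y/Y')$, where $M'\otimes X'$ is regarded as a subobject of $M\otimes X$ and $(N/N')\otimes(Y/Y')$ as a quotient of $N\otimes Y$; this is well defined. The associativity constraint is $\bar a_{X,Y,Z}=T(a_{X,Y,Z})$ and the left and right unit isomorphisms are $T(l_X)$, $T(r_X)$, where $a,l,r$ are those of $\mathcal{A}$. *)

(* Defs.v *)
From HB Require Import structures.
From mathcomp Require Import all_boot all_algebra boolp.

Set Implicit Arguments.
Unset Strict Implicit.
Unset Printing Implicit Defensive.

Import GRing.Theory.
Local Open Scope ring_scope.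
Local Open Scope quotient_scope.

Declare Scope cat_scope.
Delimit Scope cat_scope with cat.
Local Open Scope cat_scope.

Reserved Notation "g ∘ f" (at level 40, left associativity).

Record category := Category {
  Ob :> Type;
  Hom : Ob -> Ob -> Type;
  idm : forall X, Hom X X;
  compm : forall X Y Z, Hom Y Z -> Hom X Y -> Hom X Z;
  compm1 : forall X Y (f : Hom X Y), compm f (idm X) = f;
  comp1m : forall X Y (f : Hom X Y), compm (idm Y) f = f;
  compmA : forall W X Y Z (h : Hom Y Z) (g : Hom X Y) (f : Hom W X),
    compm h (compm g f) = compm (compm h g) f }.

Arguments Hom {c} _ _.
Arguments idm {c} X.
Notation "g ∘ f" := (compm g f) : cat_scope.

Definition is_mono (A : category) (X Y : A) (i : Hom X Y) : Prop :=
  forall (W : A) (f g : Hom W X), i ∘ f = i ∘ g -> f = g.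

Definition is_epi (A : category) (X Y : A) (p : Hom X Y) : Prop :=
  forall (Z : A) (f g : Hom Y Z), f ∘ p = g ∘ p -> f = g.

Definition is_iso (A : category) (X Y : A) (f : Hom X Y) : Prop :=
  exists g : Hom Y X, g ∘ f = idm X /\ f ∘ g = idm Y.

Record monoidal_data (A : category) := MonoidalData {
  tens : A -> A -> A;
  tensm : forall X X' Y Y' : A,
    Hom X X' -> Hom Y Y' -> Hom (tens X Y) (tens X' Y');
  munit : A;
  assoc : forall X Y Z : A, Hom (tens (tens X Y) Z) (tens X (tens Y Z));
  lunit : forall X : A, Hom (tens munit X) X;
  runit : forall X : A, Hom (tens X munit) X }.

Record is_monoidal (A : category) (m : monoidal_data A) : Prop := IsMonoidal {
  tensm1 : forall X Y : A, tensm m (idm X) (idm Y) = idm (tens m X Y);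
  tensm_comp : forall (X X' X'' Y Y' Y'' : A) (f' : Hom X' X'') (f : Hom X X')
      (g' : Hom Y' Y'') (g : Hom Y Y'),
    tensm m (f' ∘ f) (g' ∘ g) = tensm m f' g' ∘ tensm m f g;
  assoc_iso : forall X Y Z : A, is_iso (assoc m X Y Z);
  lunit_iso : forall X : A, is_iso (lunit m X);
  runit_iso : forall X : A, is_iso (runit m X);
  assoc_natural : forall (X X' Y Y' Z Z' : A)
      (f : Hom X X') (g : Hom Y Y') (h : Hom Z Z'),
    assoc m X' Y' Z' ∘ tensm m (tensm m f g) h =
    tensm m f (tensm m g h) ∘ assoc m X Y Z;
  lunit_natural : forall (X X' : A) (f : Hom X X'),
    lunit m X' ∘ tensm m (idm (munit m)) f = f ∘ lunit m X;
  runit_natural : forall (X X' : A) (f : Hom X X'),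
    runit m X' ∘ tensm m f (idm (munit m)) = f ∘ runit m X;
  pentagon : forall W X Y Z : A,
    assoc m W X (tens m Y Z) ∘ assoc m (tens m W X) Y Z =
    tensm m (idm W) (assoc m X Y Z) ∘ assoc m W (tens m X Y) Z
      ∘ tensm m (assoc m W X Y) (idm Z);
  triangle : forall X Y : A,
    tensm m (idm X) (lunit m Y) ∘ assoc m X (munit m) Y =
    tensm m (runit m X) (idm Y) }.

(* Bilinearity of the composition is required in is_abelian. *)
Record zmod_hom_category := ZmodHomCategory {
  zmod_hom_cat :> category;
  hom_zmod : forall X Y : zmod_hom_cat, GRing.Zmodule (Hom X Y) }.

Definition hom_zmodType (A : zmod_hom_category) (X Y : A) : zmodType :=
  GRing.Zmodule.Pack (hom_zmod X Y).

HB.instance Definition _ (A : zmod_hom_category) (X Y : A) :=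
  GRing.Zmodule.copy (Hom X Y) (hom_zmodType X Y).

Section ZmodHomNotions.
Variable A : zmod_hom_category.
Implicit Types X Y Z : A.

(* Existence of the morphisms to and from Z is given by the zero morphisms. *)
Definition is_zero_object Z : Prop :=
  forall X, (forall f g : Hom X Z, f = g) /\ (forall f g : Hom Z X, f = g).

Definition is_biproduct X Y B (i1 : Hom X B) (i2 : Hom Y B)
    (p1 : Hom B X) (p2 : Hom B Y) : Prop :=
  [/\ p1 ∘ i1 = idm X, p2 ∘ i2 = idm Y, p1 ∘ i2 = 0, p2 ∘ i1 = 0
    & i1 ∘ p1 + i2 ∘ p2 = idm B].

Definition is_kernel X Y K (f : Hom X Y) (k : Hom K X) : Prop :=
  f ∘ k = 0 /\
  forall W (h : Hom W X), f ∘ h = 0 -> exists! u : Hom W K, k ∘ u = h.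

Definition is_cokernel X Y Q (f : Hom X Y) (q : Hom Y Q) : Prop :=
  q ∘ f = 0 /\
  forall W (h : Hom Y W), h ∘ f = 0 -> exists! u : Hom Q W, u ∘ q = h.

Definition is_ses X Y Z (f : Hom X Y) (g : Hom Y Z) : Prop :=
  is_kernel g f /\ is_cokernel f g.

End ZmodHomNotions.

Record is_abelian (A : zmod_hom_category) : Prop := IsAbelian {
  compmDl : forall (X Y Z : A) (g g' : Hom Y Z) (f : Hom X Y),
    (g + g') ∘ f = g ∘ f + g' ∘ f;
  compmDr : forall (X Y Z : A) (g : Hom Y Z) (f f' : Hom X Y),
    g ∘ (f + f') = g ∘ f + g ∘ f';
  has_zero_object : exists Z : A, is_zero_object Z;
  has_biproducts : forall X Y : A, exists (B : A) (i1 : Hom X B) (i2 : Hom Y B)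
    (p1 : Hom B X) (p2 : Hom B Y), is_biproduct i1 i2 p1 p2;
  has_kernels : forall (X Y : A) (f : Hom X Y),
    exists (K : A) (k : Hom K X), is_kernel f k;
  has_cokernels : forall (X Y : A) (f : Hom X Y),
    exists (Q : A) (q : Hom Y Q), is_cokernel f q;
  mono_normal : forall (X Y : A) (i : Hom X Y), is_mono i ->
    exists (Z : A) (f : Hom Y Z), is_kernel f i;
  epi_normal : forall (X Y : A) (p : Hom X Y), is_epi p ->
    exists (Z : A) (f : Hom Z X), is_cokernel f p }.

Record abelian_category := AbelianCategory {
  ab_cat :> zmod_hom_category;
  ab_abelian : is_abelian ab_cat }.

(* An exact functor between abelian categories is automatically additive, so
   additivity of the tensor product need not be required separately. *)
Definition biexact (A : abelian_category) (m : monoidal_data A) : Prop :=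
  forall (W X Y Z : A) (f : Hom X Y) (g : Hom Y Z), is_ses f g ->
    is_ses (tensm m f (idm W)) (tensm m g (idm W)) /\
    is_ses (tensm m (idm W) f) (tensm m (idm W) g).

Record serre_subcategory (A : abelian_category) := SerreSubcategory {
  in_serre :> A -> Prop;
  serre_zero : forall Z : A, is_zero_object Z -> in_serre Z;
  serre_biproduct : forall (X Y B : A) (i1 : Hom X B) (i2 : Hom Y B)
      (p1 : Hom B X) (p2 : Hom B Y),
    is_biproduct i1 i2 p1 p2 -> in_serre X -> in_serre Y -> in_serre B;
  serre_sub : forall (X Y : A) (i : Hom X Y),
    is_mono i -> in_serre Y -> in_serre X;
  serre_quot : forall (X Y : A) (p : Hom X Y),
    is_epi p -> in_serre X -> in_serre Y;
  serre_ext : forall (X Y Z : A) (f : Hom X Y) (g : Hom Y Z),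
    is_ses f g -> in_serre X -> in_serre Z -> in_serre Y }.

Definition two_sided_tensor_ideal (A : abelian_category) (m : monoidal_data A)
    (C : serre_subcategory A) : Prop :=
  forall X Y : A, C Y -> C (tens m X Y) /\ C (tens m Y X).

Section AbelianFacts.
Variable A : abelian_category.
Implicit Types W X Y Z K Q : A.

Let abA := ab_abelian A.

Lemma comp0m X Y Z (f : Hom X Y) : (0 : Hom Y Z) ∘ f = 0.
Proof.
by apply: (@addrI _ ((0 : Hom Y Z) ∘ f)); rewrite -(compmDl abA) !addr0.
Qed.

Lemma compm0 X Y Z (g : Hom Y Z) : g ∘ (0 : Hom X Y) = 0.
Proof.
by apply: (@addrI _ (g ∘ (0 : Hom X Y))); rewrite -(compmDr abA) !addr0.
Qed.

Lemma compmNl X Y Z (g : Hom Y Z) (f : Hom X Y) : (- g) ∘ f = - (g ∘ f).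
Proof. by apply: (@addrI _ (g ∘ f)); rewrite -(compmDl abA) !subrr comp0m. Qed.

Lemma compmNr X Y Z (g : Hom Y Z) (f : Hom X Y) : g ∘ (- f) = - (g ∘ f).
Proof. by apply: (@addrI _ (g ∘ f)); rewrite -(compmDr abA) !subrr compm0. Qed.

Lemma compmBl X Y Z (g g' : Hom Y Z) (f : Hom X Y) :
  (g - g') ∘ f = g ∘ f - g' ∘ f.
Proof. by rewrite (compmDl abA) compmNl. Qed.

Lemma compmBr X Y Z (g : Hom Y Z) (f f' : Hom X Y) :
  g ∘ (f - f') = g ∘ f - g ∘ f'.
Proof. by rewrite (compmDr abA) compmNr. Qed.

Lemma mono0P X Y (i : Hom X Y) :
  (forall W (h : Hom W X), i ∘ h = 0 -> h = 0) -> is_mono i.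
Proof.
move=> i0 W f g e; apply/eqP; rewrite -subr_eq0; apply/eqP/i0.
by rewrite compmBr e subrr.
Qed.

Lemma epi0P X Y (p : Hom X Y) :
  (forall W (h : Hom Y W), h ∘ p = 0 -> h = 0) -> is_epi p.
Proof.
move=> p0 W f g e; apply/eqP; rewrite -subr_eq0; apply/eqP/p0.
by rewrite compmBl e subrr.
Qed.

Lemma mono0 X Y (i : Hom X Y) W (h : Hom W X) : is_mono i -> i ∘ h = 0 -> h = 0.
Proof. by move=> mi e; apply: mi; rewrite e compm0. Qed.

Lemma epi0 X Y (p : Hom X Y) W (h : Hom Y W) : is_epi p -> h ∘ p = 0 -> h = 0.
Proof. by move=> ep e; apply: ep; rewrite e comp0m. Qed.

Lemma id_mono X : is_mono (idm X).
Proof. by move=> W f g; rewrite !comp1m. Qed.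

Lemma id_epi X : is_epi (idm X).
Proof. by move=> W f g; rewrite !compm1. Qed.

Lemma comp_mono X Y Z (g : Hom Y Z) (f : Hom X Y) :
  is_mono g -> is_mono f -> is_mono (g ∘ f).
Proof. by move=> mg mf W u v; rewrite -!compmA => /mg /mf. Qed.

Lemma comp_epi X Y Z (g : Hom Y Z) (f : Hom X Y) :
  is_epi g -> is_epi f -> is_epi (g ∘ f).
Proof. by move=> eg ef W u v; rewrite !compmA => /ef /eg. Qed.

Lemma mono_cancel X Y Z (g : Hom Y Z) (f : Hom X Y) :
  is_mono (g ∘ f) -> is_mono f.
Proof. by move=> m W u v e; apply: m; rewrite -!compmA e. Qed.

Lemma epi_cancel X Y Z (g : Hom Y Z) (f : Hom X Y) :
  is_epi (g ∘ f) -> is_epi g.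
Proof. by move=> m W u v e; apply: m; rewrite !compmA e. Qed.

Lemma ker_mono X Y K (f : Hom X Y) (k : Hom K X) : is_kernel f k -> is_mono k.
Proof.
case=> fk uk W u v e; have := uk _ (k ∘ u).
by rewrite compmA fk comp0m => /(_ erefl)[w [_ un]]; rewrite -(un u)// (un v).
Qed.

Lemma coker_epi X Y Q (f : Hom X Y) (q : Hom Y Q) : is_cokernel f q -> is_epi q.
Proof.
case=> qf uq W u v e; have := uq _ (u ∘ q).
by rewrite -compmA qf compm0 => /(_ erefl)[w [_ un]]; rewrite -(un u)// (un v).
Qed.

Lemma ker_lift X Y K (f : Hom X Y) (k : Hom K X) W (h : Hom W X) :
  is_kernel f k -> f ∘ h = 0 -> exists u, k ∘ u = h.
Proof. by case=> _ uk /uk[u [e _]]; exists u. Qed.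

Lemma coker_desc X Y Q (f : Hom X Y) (q : Hom Y Q) W (h : Hom Y W) :
  is_cokernel f q -> h ∘ f = 0 -> exists u, u ∘ q = h.
Proof. by case=> _ uq /uq[u [e _]]; exists u. Qed.

Lemma kernelI X Y K (f : Hom X Y) (k : Hom K X) : is_mono k -> f ∘ k = 0 ->
  (forall W (h : Hom W X), f ∘ h = 0 -> exists u, k ∘ u = h) -> is_kernel f k.
Proof.
move=> mk fk uk; split=> // W h /uk[u e]; exists u; split=> // v e'.
by apply: mk; rewrite e e'.
Qed.

Lemma cokernelI X Y Q (f : Hom X Y) (q : Hom Y Q) : is_epi q -> q ∘ f = 0 ->
  (forall W (h : Hom Y W), h ∘ f = 0 -> exists u, u ∘ q = h) -> is_cokernel f q.
Proof.
move=> mk fk uk; split=> // W h /uk[u e]; exists u; split=> // v e'.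
by apply: mk; rewrite e e'.
Qed.

Lemma mono_ker X Y Q (i : Hom X Y) (q : Hom Y Q) :
  is_mono i -> is_cokernel i q -> is_kernel q i.
Proof.
move=> mi cq; have [Z [f kf]] := mono_normal abA mi.
apply: kernelI => //; first by case: cq.
have [u e] := coker_desc cq (proj1 kf).
by move=> W h qh; apply: (ker_lift kf); rewrite -e -compmA qh compm0.
Qed.

Lemma epi_coker X Y K (p : Hom X Y) (k : Hom K X) :
  is_epi p -> is_kernel p k -> is_cokernel k p.
Proof.
move=> mi cq; have [Z [f kf]] := epi_normal abA mi.
apply: cokernelI => //; first by case: cq.
have [u e] := ker_lift cq (proj1 kf).
by move=> W h qh; apply: (coker_desc kf); rewrite -e compmA qh comp0m.
Qed.

Lemma mono_epi_desc X Y (i : Hom X Y) Z W (a : Hom Z X) (m : Hom W Y)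
    (e : Hom Z W) : is_mono i -> is_epi e -> i ∘ a = m ∘ e ->
  exists u, i ∘ u = m.
Proof.
move=> mi ee ea; have [Q [q cq]] := has_cokernels abA i.
apply: (ker_lift (mono_ker mi cq)); apply: (epi0 ee).
by rewrite -compmA -ea compmA (proj1 cq) comp0m.
Qed.

Lemma image_fact X Y (f : Hom X Y) :
  exists (I : A) (e : Hom X I) (m : Hom I Y), [/\ is_epi e, is_mono m & f = m ∘ e].
Proof.
have [Q [q cq]] := has_cokernels abA f.
have [I [m km]] := has_kernels abA q.
have mm := ker_mono km.
have [e ee] := ker_lift km (proj1 cq).
exists I, e, m; split=> //; apply: epi0P => T t te.
have [J [n kn]] := has_kernels abA t.
have [e' ee'] := ker_lift kn te.
have [Z [w kw]] := mono_normal abA (comp_mono mm (ker_mono kn)).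
have wf : w ∘ f = 0.
  by rewrite -ee -ee' !compmA -(compmA w) (proj1 kw) comp0m.
have [w' ew] := coker_desc cq wf.
have wm : w ∘ m = 0 by rewrite -ew -compmA (proj1 km) compm0.
have [x ex] := ker_lift kw wm.
have nx : n ∘ x = idm I by apply: mm; rewrite compmA ex compm1.
by rewrite -(compm1 t) -nx compmA (proj1 kn) comp0m.
Qed.

Definition is_pullback X Y Z E (f : Hom X Z) (g : Hom Y Z)
    (a : Hom E X) (b : Hom E Y) : Prop :=
  f ∘ a = g ∘ b /\
  forall W (x : Hom W X) (y : Hom W Y), f ∘ x = g ∘ y ->
    exists! u : Hom W E, a ∘ u = x /\ b ∘ u = y.

(* Constructed as the kernel of (f, -g) : X ⊕ Y -> Z. *)
Lemma pullback_strong X Y Z (f : Hom X Z) (g : Hom Y Z) :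
  exists (E : A) (a : Hom E X) (b : Hom E Y),
    is_pullback f g a b /\ (is_epi g -> is_epi a).
Proof.
have [B [i1 [i2 [p1 [p2 [e11 e22 e12 e21 eB]]]]]] := has_biproducts abA X Y.
pose d := f ∘ p1 - g ∘ p2.
have [E [k kk]] := has_kernels abA d.
exists E, (p1 ∘ k), (p2 ∘ k); split; first split.
- by apply/eqP; rewrite -subr_eq0 !compmA -compmBl (proj1 kk).
- move=> W x y e.
  have e1 : p1 ∘ (i1 ∘ x + i2 ∘ y) = x.
    by rewrite (compmDr abA) !compmA e11 e12 comp1m comp0m addr0.
  have e2 : p2 ∘ (i1 ∘ x + i2 ∘ y) = y.
    by rewrite (compmDr abA) !compmA e21 e22 comp1m comp0m add0r.
  have dz : d ∘ (i1 ∘ x + i2 ∘ y) = 0.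
    by rewrite /d compmBl -!compmA e1 e2 e subrr.
  have [u eu] := ker_lift kk dz; exists u; split.
    by rewrite -!compmA eu.
  move=> v [ev1 ev2]; apply: (ker_mono kk).
  rewrite eu -(comp1m (k ∘ v)) -eB (compmDl abA).
  by rewrite -!compmA (compmA p1) (compmA p2) ev1 ev2.
move=> eg.
have ed : is_epi d.
  apply: epi0P => W h; move/(congr1 (fun z => z ∘ i2)).
  rewrite comp0m /d compmBr compmBl -!compmA e12 e22 !compm0 compm1 sub0r.
  by move/eqP; rewrite oppr_eq0 => /eqP; apply: epi0.
apply: epi0P => T t et.
have [u eu] : exists u, u ∘ d = t ∘ p1.
  by apply: (coker_desc (epi_coker ed kk)); rewrite -compmA.
have ug : u = 0.
  apply: (epi0 eg); move/(congr1 (fun z => z ∘ i2)): eu.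
  rewrite /d compmBr compmBl -!compmA e12 e22 !compm0 compm1 sub0r.
  by move/eqP; rewrite oppr_eq0 => /eqP.
by rewrite -(compm1 t) -e11 compmA -eu ug !comp0m.
Qed.

Lemma lift_epi X Y (p : Hom X Y) W (y : Hom W Y) : is_epi p ->
  exists W' (e : Hom W' W) (x : Hom W' X), is_epi e /\ p ∘ x = y ∘ e.
Proof.
move=> ep; have [E [a [b [[e _] ea]]]] := pullback_strong y p.
by exists E, a, b; split; [apply: ea|].
Qed.

Lemma lift_im X Y Q (g : Hom X Y) (d : Hom Y Q) W (z : Hom W Y) :
  is_cokernel g d -> d ∘ z = 0 ->
  exists W' (e : Hom W' W) (x : Hom W' X), is_epi e /\ g ∘ x = z ∘ e.
Proof.
move=> cd dz; have [I [e [m [ee mm eg]]]] := image_fact g.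
have [u eu] : exists u, m ∘ u = z.
  have [Q' [q cq]] := has_cokernels abA m.
  apply: (ker_lift (mono_ker mm cq)).
  have [v ev] : exists v, v ∘ d = q.
    by apply: (coker_desc cd); rewrite eg compmA (proj1 cq) comp0m.
  by rewrite -ev -compmA dz compm0.
have [W' [w [x [ew ex]]]] := lift_epi u ee.
by exists W', w, x; split=> //; rewrite eg -eu -!compmA ex.
Qed.

Lemma pullback_ex X Y Z (f : Hom X Z) (g : Hom Y Z) :
  exists (E : A) (a : Hom E X) (b : Hom E Y), is_pullback f g a b.
Proof.
by have [E [a [b [pb _]]]] := pullback_strong f g; exists E, a, b.
Qed.

Lemma pullback_epi X Y Z E (f : Hom X Z) (g : Hom Y Z) (a : Hom E X)
    (b : Hom E Y) : is_pullback f g a b -> is_epi g -> is_epi a.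
Proof.
move=> [_ up] eg; have [E' [a' [b' [[e' _] ea']]]] := pullback_strong f g.
have [u [[e1 _] _]] := up _ _ _ e'.
by apply: (@epi_cancel _ _ _ a u); rewrite e1; apply: ea'.
Qed.

Lemma pullback_joint X Y Z E (f : Hom X Z) (g : Hom Y Z) (a : Hom E X)
    (b : Hom E Y) W (u v : Hom W E) : is_pullback f g a b ->
  a ∘ u = a ∘ v -> b ∘ u = b ∘ v -> u = v.
Proof.
move=> [e up] ea eb; have [|w [_ un]] := up _ (a ∘ u) (b ∘ u).
  by rewrite !compmA e.
by rewrite -(un u)// (un v).
Qed.

Definition ker_sig X Y (f : Hom X Y) :
    {K : A & {k : Hom K X | is_kernel f k}} :=
  let: exist K HK := cid (has_kernels abA f) in existT _ K (cid HK).
Definition ker X Y (f : Hom X Y) : A := projT1 (ker_sig f).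
Definition kerm X Y (f : Hom X Y) : Hom (ker f) X := proj1_sig (projT2 (ker_sig f)).
Lemma kermP X Y (f : Hom X Y) : is_kernel f (kerm f).
Proof. exact: proj2_sig (projT2 (ker_sig f)). Qed.

Definition coker_sig X Y (f : Hom X Y) :
    {Q : A & {q : Hom Y Q | is_cokernel f q}} :=
  let: exist Q HQ := cid (has_cokernels abA f) in existT _ Q (cid HQ).
Definition coker X Y (f : Hom X Y) : A := projT1 (coker_sig f).
Definition cokerm X Y (f : Hom X Y) : Hom Y (coker f) :=
  proj1_sig (projT2 (coker_sig f)).
Lemma cokermP X Y (f : Hom X Y) : is_cokernel f (cokerm f).
Proof. exact: proj2_sig (projT2 (coker_sig f)). Qed.

Definition pullback_sig X Y Z (f : Hom X Z) (g : Hom Y Z) :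
    {E : A & {a : Hom E X & {b : Hom E Y | is_pullback f g a b}}} :=
  let: exist E HE := cid (pullback_ex f g) in
  let: exist a Ha := cid HE in existT _ E (existT _ a (cid Ha)).
Definition pullback X Y Z (f : Hom X Z) (g : Hom Y Z) : A :=
  projT1 (pullback_sig f g).
Definition pb1 X Y Z (f : Hom X Z) (g : Hom Y Z) : Hom (pullback f g) X :=
  projT1 (projT2 (pullback_sig f g)).
Definition pb2 X Y Z (f : Hom X Z) (g : Hom Y Z) : Hom (pullback f g) Y :=
  proj1_sig (projT2 (projT2 (pullback_sig f g))).
Lemma pullbackP X Y Z (f : Hom X Z) (g : Hom Y Z) :
  is_pullback f g (pb1 f g) (pb2 f g).
Proof. exact: proj2_sig (projT2 (projT2 (pullback_sig f g))). Qed.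

End AbelianFacts.

Section SerreFacts.
Variables (A : abelian_category) (C : serre_subcategory A).
Implicit Types W X Y Z K Q : A.

Let abA := ab_abelian A.

Definition kernel_in X Y (f : Hom X Y) : Prop :=
  exists (K : A) (k : Hom K X), is_kernel f k /\ C K.

Definition cokernel_in X Y (f : Hom X Y) : Prop :=
  exists (Q : A) (q : Hom Y Q), is_cokernel f q /\ C Q.

Lemma kernel_inP X Y (f : Hom X Y) K (k : Hom K X) :
  is_kernel f k -> kernel_in f -> C K.
Proof.
move=> kk [K' [k' [kk' CK']]]; have [u eu] := ker_lift kk' (proj1 kk).
apply: (serre_sub _ CK'); apply: (@mono_cancel _ _ _ _ k' u).
by rewrite eu; apply: ker_mono kk.
Qed.

Lemma cokernel_inP X Y (f : Hom X Y) Q (q : Hom Y Q) :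
  is_cokernel f q -> cokernel_in f -> C Q.
Proof.
move=> kk [K' [k' [kk' CK']]]; have [u eu] := coker_desc kk' (proj1 kk).
apply: (serre_quot _ CK'); apply: (@epi_cancel _ _ _ _ u k').
by rewrite eu; apply: coker_epi kk.
Qed.

Lemma mono_kernel_in X Y (f : Hom X Y) : is_mono f -> kernel_in f.
Proof.
move=> mf; have [Z z0] := has_zero_object abA.
exists Z, 0; split; last exact: serre_zero.
apply: kernelI; [|exact: compm0|].
  by move=> W u v _; apply: (z0 W).1.
by move=> W h /(mono0 mf)->; exists 0; rewrite compm0.
Qed.

Lemma epi_cokernel_in X Y (f : Hom X Y) : is_epi f -> cokernel_in f.
Proof.
move=> mf; have [Z z0] := has_zero_object abA.
exists Z, 0; split; last exact: serre_zero.
apply: cokernelI; [|exact: comp0m|].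
  by move=> W u v _; apply: (z0 W).2.
by move=> W h /(epi0 mf)->; exists 0; rewrite comp0m.
Qed.

Lemma kernel_in_obj X Y (f : Hom X Y) : kernel_in f -> C Y -> C X.
Proof.
move=> [K [k [kk CK]]] CY; have [I [e [m [ee mm ef]]]] := image_fact f.
have ke : is_kernel e k.
  apply: kernelI; first exact: ker_mono kk.
    by apply: (mono0 mm); rewrite compmA -ef (proj1 kk).
  by move=> W h eh; apply: (ker_lift kk); rewrite ef -compmA eh compm0.
by apply: (serre_ext (conj ke (epi_coker ee ke)) CK); apply: serre_sub mm CY.
Qed.

Lemma cokernel_in_obj X Y (f : Hom X Y) : cokernel_in f -> C X -> C Y.
Proof.
move=> [K [k [kk CK]]] CY; have [I [e [m [ee mm ef]]]] := image_fact f.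
have ke : is_cokernel m k.
  apply: cokernelI; first exact: coker_epi kk.
    by apply: (epi0 ee); rewrite -compmA -ef (proj1 kk).
  by move=> W h eh; apply: (coker_desc kk); rewrite ef compmA eh comp0m.
apply: (serre_ext (conj (mono_ker mm ke) ke) _ CK); exact: serre_quot ee CY.
Qed.

Lemma kernel_in_comp X Y Z (g : Hom Y Z) (f : Hom X Y) :
  kernel_in g -> kernel_in f -> kernel_in (g ∘ f).
Proof.
move=> [Kg [kg [kkg Cg]]] [Kf [kf [kkf Cf]]].
have [K [k kk]] := has_kernels abA (g ∘ f); exists K, k; split=> //.
have [u eu] : exists u, kg ∘ u = f ∘ k.
  by apply: (ker_lift kkg); rewrite compmA (proj1 kk).
apply: (kernel_in_obj (f := u)) => //.
have [L [l kl]] := has_kernels abA u; exists L, l; split=> //.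
have [v ev] : exists v, kf ∘ v = k ∘ l.
  by apply: (ker_lift kkf); rewrite compmA -eu -compmA (proj1 kl) compm0.
apply: (serre_sub (i := v) _ Cf); apply: (@mono_cancel _ _ _ _ kf).
by rewrite ev; apply: comp_mono (ker_mono kk) (ker_mono kl).
Qed.

Lemma cokernel_in_comp X Y Z (g : Hom Y Z) (f : Hom X Y) :
  cokernel_in g -> cokernel_in f -> cokernel_in (g ∘ f).
Proof.
move=> [Kg [kg [kkg Cg]]] [Kf [kf [kkf Cf]]].
have [K [k kk]] := has_cokernels abA (g ∘ f); exists K, k; split=> //.
have [u eu] : exists u, u ∘ kf = k ∘ g.
  by apply: (coker_desc kkf); rewrite -compmA (proj1 kk).
apply: (cokernel_in_obj (f := u)) => //.
have [L [l kl]] := has_cokernels abA u; exists L, l; split=> //.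
have [v ev] : exists v, v ∘ kg = l ∘ k.
  by apply: (coker_desc kkg); rewrite -compmA -eu compmA (proj1 kl) comp0m.
apply: (serre_quot (p := v) _ Cg); apply: (@epi_cancel _ _ _ _ v kg).
by rewrite ev; apply: comp_epi (coker_epi kl) (coker_epi kk).
Qed.

Lemma kernel_in_cancel X Y Z (g : Hom Y Z) (f : Hom X Y) :
  kernel_in (g ∘ f) -> kernel_in f.
Proof.
move=> [K [k [kk CK]]]; have [L [l kl]] := has_kernels abA f.
exists L, l; split=> //.
have [u eu] : exists u, k ∘ u = l.
  by apply: (ker_lift kk); rewrite -compmA (proj1 kl) compm0.
apply: (serre_sub (i := u) _ CK); apply: (@mono_cancel _ _ _ _ k).
by rewrite eu; apply: ker_mono kl.
Qed.

Lemma cokernel_in_cancel X Y Z (g : Hom Y Z) (f : Hom X Y) :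
  cokernel_in (g ∘ f) -> cokernel_in g.
Proof.
move=> [K [k [kk CK]]]; have [L [l kl]] := has_cokernels abA g.
exists L, l; split=> //.
have [u eu] : exists u, u ∘ k = l.
  by apply: (coker_desc kk); rewrite compmA (proj1 kl) comp0m.
apply: (serre_quot (p := u) _ CK); apply: (@epi_cancel _ _ _ _ u k).
by rewrite eu; apply: coker_epi kl.
Qed.

Lemma pullback_kernel_in X Y Z E (f : Hom X Z) (g : Hom Y Z) (a : Hom E X)
    (b : Hom E Y) : is_pullback f g a b -> kernel_in g -> kernel_in a.
Proof.
move=> pb [K [k [kk CK]]]; have [L [l kl]] := has_kernels abA a.
exists L, l; split=> //.
have [u eu] : exists u, k ∘ u = b ∘ l.
  apply: (ker_lift kk); rewrite compmA -(proj1 pb) -compmA (proj1 kl).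
  exact: compm0.
apply: (serre_sub (i := u) _ CK); apply: mono0P => W h uh.
apply: (mono0 (ker_mono kl)); apply: (pullback_joint pb).
  by rewrite compmA (proj1 kl) comp0m compm0.
by rewrite compmA -eu -compmA uh !compm0.
Qed.

Lemma pullback_cokernel_in X Y Z E (f : Hom X Z) (g : Hom Y Z) (a : Hom E X)
    (b : Hom E Y) : is_pullback f g a b -> cokernel_in g -> cokernel_in a.
Proof.
move=> pb [D' [d [kd CD']]]; have [D [c kc]] := has_cokernels abA a.
exists D, c; split=> //.
have [u eu] : exists u, u ∘ c = d ∘ f.
  apply: (coker_desc kc); rewrite -compmA (proj1 pb) compmA (proj1 kd).
  exact: comp0m.
apply: (serre_sub (i := u) _ CD'); apply: mono0P => W y uy.
have [W1 [e1 [x [ee1 ex]]]] := lift_epi y (coker_epi kc).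
have dfx : d ∘ (f ∘ x) = 0 by rewrite compmA -eu -compmA ex compmA uy comp0m.
have [W2 [e2 [y' [ee2 ey]]]] := lift_im kd dfx.
have [e' [[ea _] _]] := proj2 pb _ (x ∘ e2) y' (etrans (compmA _ _ _) (esym ey)).
apply: (epi0 ee1); apply: (epi0 ee2).
by rewrite -ex -compmA -ea compmA (proj1 kc) comp0m.
Qed.

Lemma coker_kernel_in K X Q (w : Hom K X) (v : Hom X Q) :
  is_cokernel w v -> C K -> kernel_in v.
Proof.
move=> kv CK; have [I [e [m [ee mm ew]]]] := image_fact w.
exists I, m; split; last exact: serre_quot ee CK.
apply: kernelI => //.
  by apply: (epi0 ee); rewrite -compmA -ew (proj1 kv).
move=> W h vh; have [W' [e' [x [ee' ex]]]] := lift_im kv vh.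
by apply: (mono_epi_desc (a := e ∘ x) mm ee'); rewrite compmA -ew.
Qed.

Definition serre_iso X Y (f : Hom X Y) : Prop := kernel_in f /\ cokernel_in f.

Lemma id_serre_iso X : serre_iso (idm X).
Proof.
by split; [apply/mono_kernel_in/id_mono|apply/epi_cokernel_in/id_epi].
Qed.

Lemma comp_serre_iso X Y Z (g : Hom Y Z) (f : Hom X Y) :
  serre_iso g -> serre_iso f -> serre_iso (g ∘ f).
Proof.
by move=> [? ?] [? ?]; split; [apply: kernel_in_comp|apply: cokernel_in_comp].
Qed.

Lemma pullback_serre_iso X Y Z E (f : Hom X Z) (g : Hom Y Z) (a : Hom E X)
    (b : Hom E Y) : is_pullback f g a b -> serre_iso g -> serre_iso a.
Proof.
move=> pb [? ?]; split; first exact: pullback_kernel_in pb _.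
exact: pullback_cokernel_in pb _.
Qed.

Lemma ker_serre_iso E Z K J (d : Hom E Z) (j : Hom J Z) (w : Hom E J)
    (k : Hom K E) : is_mono j -> C J -> d = j ∘ w -> is_kernel d k -> serre_iso k.
Proof.
move=> mj CJ ed kk; split; first exact: mono_kernel_in (ker_mono kk).
have [D [c kc]] := has_cokernels abA k; exists D, c; split=> //.
have [d' ed'] := coker_desc kc (proj1 kk).
have wk : w ∘ k = 0 by apply: (mono0 mj); rewrite compmA -ed (proj1 kk).
have [w' ew] := coker_desc kc wk.
apply: (serre_sub (i := w') _ CJ); apply: mono0P => W y wy.
have [W1 [e1 [x [ee1 ex]]]] := lift_epi y (coker_epi kc).
have dx : d ∘ x = 0 by rewrite ed -ew -!compmA ex (compmA w') wy comp0m compm0.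
have [u eu] := ker_lift kk dx.
by apply: (epi0 ee1); rewrite -ex -eu compmA (proj1 kc) comp0m.
Qed.

End SerreFacts.

Section Quotient.
Variables (A : abelian_category) (C : serre_subcategory A).
Implicit Types W X Y Z K Q M N P : A.

(* An element of the direct system defining Hom_{A/C}(M, N): a morphism
   M' -> N/N', where M' is given by a monomorphism into M with cokernel in C,
   and N/N' by an epimorphism out of N with kernel N' in C. *)
Record qrep M N := QRep {
  qdom : A;
  qinc : Hom qdom M;
  qcod : A;
  qproj : Hom N qcod;
  qmap : Hom qdom qcod;
  qinc_mono : is_mono qinc;
  qinc_coker : cokernel_in C qinc;
  qproj_epi : is_epi qproj;
  qproj_ker : kernel_in C qproj }.

HB.instance Definition _ M N := gen_eqMixin (qrep M N).
HB.instance Definition _ M N := gen_choiceMixin (qrep M N).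

(* Equality in the direct limit: f and g become equal in Hom(M'', N/N'') for
   some M'' contained in both domains and N'' containing both kernels. *)
Definition qrep_eq M N (f g : qrep M N) : Prop :=
  exists (M'' Q'' : A) (k : Hom M'' M) (r : Hom N Q'')
         (u : Hom M'' (qdom f)) (u' : Hom M'' (qdom g))
         (v : Hom (qcod f) Q'') (v' : Hom (qcod g) Q''),
    [/\ is_mono k /\ cokernel_in C k,
        is_epi r /\ kernel_in C r,
        qinc f ∘ u = k /\ qinc g ∘ u' = k,
        v ∘ qproj f = r /\ v' ∘ qproj g = r
      & v ∘ qmap f ∘ u = v' ∘ qmap g ∘ u'].

(* The roof M <- E -> N represents the same morphism of A/C as f. *)
Definition is_roof M N (f : qrep M N) E (s : Hom E M) (t : Hom E N) : Prop :=
  serre_iso C s /\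
  exists s' : Hom E (qdom f), qinc f ∘ s' = s /\ qproj f ∘ t = qmap f ∘ s'.

Lemma roof_ex M N (f : qrep M N) :
  exists (E : A) (s : Hom E M) (t : Hom E N), is_roof f s t.
Proof.
have [E [a [b pb]]] := pullback_ex (qmap f) (qproj f).
exists E, (qinc f ∘ a), b; split; last by exists a; rewrite (proj1 pb).
apply: comp_serre_iso.
  by split; [apply/mono_kernel_in/qinc_mono|apply: qinc_coker].
apply: (pullback_serre_iso pb).
by split; [apply: qproj_ker|apply/epi_cokernel_in/qproj_epi].
Qed.

Lemma roof_restr M N (f : qrep M N) E (s : Hom E M) (t : Hom E N)
    E' (u : Hom E' E) :
  is_roof f s t -> serre_iso C u -> is_roof f (s ∘ u) (t ∘ u).
Proof.
move=> [cs [s' [es et]]] cu; split; first exact: comp_serre_iso.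
by exists (s' ∘ u); rewrite !compmA es et.
Qed.

Lemma quot_directed N Q Q1 (p : Hom N Q) (p1 : Hom N Q1) :
  is_epi p -> kernel_in C p -> is_epi p1 -> kernel_in C p1 ->
  exists Q'' (r : Hom N Q'') v v',
    [/\ is_epi r, kernel_in C r, v ∘ p = r & v' ∘ p1 = r].
Proof.
move=> ep kp ep1 [K1 [k1 [kk1 CK1]]].
have cv := cokermP (p ∘ k1); set v := cokerm _ in cv.
have [|v' ev'] := coker_desc (h := v ∘ p) (epi_coker ep1 kk1).
  by rewrite -compmA (proj1 cv).
exists (coker (p ∘ k1)), (v ∘ p), v, v'; split=> //.
- exact: comp_epi (coker_epi cv) ep.
- by apply: kernel_in_comp => //; apply: coker_kernel_in cv CK1.
Qed.

Lemma roof_eq M N (f g : qrep M N) E (s : Hom E M) (t : Hom E N) :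
  is_roof f s t -> is_roof g s t -> qrep_eq f g.
Proof.
move=> [cs [s' [es et]]] [_ [s1 [es1 et1]]].
have [I [e [m [ee mm em]]]] := image_fact s.
have cm : cokernel_in C m.
  by apply: (@cokernel_in_cancel _ C _ _ _ _ e); rewrite -em; case: cs.
have [u eu] := mono_epi_desc (@qinc_mono _ _ f) ee (etrans es em).
have [u1 eu1] := mono_epi_desc (@qinc_mono _ _ g) ee (etrans es1 em).
have [Q'' [r [v [v1 [er kr ev ev1]]]]] := quot_directed (@qproj_epi _ _ f)
  (@qproj_ker _ _ f) (@qproj_epi _ _ g) (@qproj_ker _ _ g).
exists I, Q'', m, r, u, u1, v, v1; split=> //.
have ue : u ∘ e = s' by apply: (@qinc_mono _ _ f); rewrite compmA eu es em.
have ue1 : u1 ∘ e = s1 by apply: (@qinc_mono _ _ g); rewrite compmA eu1 es1 em.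
apply: ee; rewrite -!compmA ue ue1 -et -et1.
by rewrite !compmA ev ev1.
Qed.

Lemma qrep_eq_roof M N (f g : qrep M N) E (s : Hom E M) (t : Hom E N) :
  qrep_eq f g -> is_roof f s t ->
  exists E' (u : Hom E' E), serre_iso C u /\ is_roof g (s ∘ u) (t ∘ u).
Proof.
move=> [M2 [Q2 [k [r [u [u1 [v [v1]]]]]]]].
move=> [[mk ck] [er kr] [eu eu1] [ev ev1] E12] [cs [s' [es et]]].
have [E1 [a [b pb]]] := pullback_ex s k.
have ca : serre_iso C a.
  by apply: (pullback_serre_iso pb); split=> //; apply: mono_kernel_in.
have s'a : s' ∘ a = u ∘ b.
  by apply: (@qinc_mono _ _ f); rewrite !compmA es eu (proj1 pb).
pose d := qproj g ∘ (t ∘ a) - qmap g ∘ (u1 ∘ b).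
have vd : v1 ∘ d = 0.
  apply/eqP; rewrite compmBr !compmA subr_eq0 ev1 -ev -E12.
  by rewrite -!compmA -s'a (compmA (qproj f)) et !compmA.
have [J [j [kj CJ]]] : kernel_in C v1.
  have [L [l kl]] := has_kernels (ab_abelian A) v1; exists L, l; split=> //.
  have [K [kr' [kkr CK]]] := kr.
  have [F [x [y [[exy ux] ey]]]] := pullback_strong l (qproj g).
  have ex : is_epi x by apply: ey; apply: qproj_epi.
  have [w ew] : exists w, kr' ∘ w = y.
    apply: (ker_lift kkr).
    by rewrite -ev1 -compmA -exy compmA (proj1 kl) comp0m.
  have [z ez] : exists z, l ∘ z = qproj g ∘ kr'.
    by apply: (ker_lift kl); rewrite compmA ev1 (proj1 kkr).
  have ez' : z ∘ w = x.
    by apply: (ker_mono kl); rewrite compmA ez -compmA ew.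
  apply: (serre_quot (p := z) _ CK).
  by apply: (@epi_cancel _ _ _ _ z w); rewrite ez'.
have [w ew] := ker_lift kj vd.
have [E' [c kc]] := has_kernels (ab_abelian A) d.
have cc := ker_serre_iso (ker_mono kj) CJ (esym ew) kc.
have cac := comp_serre_iso ca cc.
exists E', (a ∘ c); split=> //; split; first exact: comp_serre_iso.
exists (u1 ∘ b ∘ c); split.
  by rewrite !compmA eu1 -(proj1 pb).
apply/eqP; rewrite -subr_eq0; apply/eqP; rewrite -(proj1 kc) /d compmBl.
by rewrite !compmA.
Qed.

Lemma qrep_eq_refl M N (f : qrep M N) : qrep_eq f f.
Proof. by have [E [s [t rf]]] := roof_ex f; exact: (roof_eq rf rf). Qed.

Lemma qrep_eq_sym M N (f g : qrep M N) : qrep_eq f g -> qrep_eq g f.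
Proof.
move=> [M2 [Q2 [k [r [u [u1 [v [v1 [? ? [? ?] [? ?] ?]]]]]]]]].
by exists M2, Q2, k, r, u1, u, v1, v; split.
Qed.

Lemma qrep_eq_trans M N (f g h : qrep M N) :
  qrep_eq f g -> qrep_eq g h -> qrep_eq f h.
Proof.
move=> fg gh; have [E [s [t r]]] := roof_ex f.
have [E1 [u [cu r1]]] := qrep_eq_roof fg r.
have [E2 [w [cw r2]]] := qrep_eq_roof gh r1.
by apply: roof_eq r2; apply: roof_restr cw; apply: roof_restr cu.
Qed.

Definition qrep_eqb M N : rel (qrep M N) := fun f g => `[< qrep_eq f g >].

Lemma qrep_eqb_refl M N : reflexive (@qrep_eqb M N).
Proof. by move=> f; apply/asboolP/qrep_eq_refl. Qed.

Lemma qrep_eqb_sym M N : symmetric (@qrep_eqb M N).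
Proof. by move=> f g; apply/asboolP/asboolP; apply: qrep_eq_sym. Qed.

Lemma qrep_eqb_trans M N : transitive (@qrep_eqb M N).
Proof.
by move=> g f h /asboolP fg /asboolP gh; apply/asboolP/(qrep_eq_trans fg gh).
Qed.

Definition qrep_equiv M N : equiv_rel (qrep M N) :=
  EquivRel (@qrep_eqb M N) (@qrep_eqb_refl M N) (@qrep_eqb_sym M N)
    (@qrep_eqb_trans M N).

Definition qhom M N : Type := {eq_quot qrep_equiv M N}.

(* The morphism T f of A/C represented by f. *)
Definition qclass M N (f : qrep M N) : qhom M N :=
  \pi_({eq_quot qrep_equiv M N})%qT f.

Definition qrepr M N (F : qhom M N) : qrep M N := repr F.

Lemma qreprK M N (F : qhom M N) : qclass (qrepr F) = F.
Proof. exact: reprK. Qed.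

Lemma qclassP M N (f g : qrep M N) : qclass f = qclass g <-> qrep_eq f g.
Proof.
split; first by move=> e; apply/asboolP/(eqmodP (qrep_equiv M N)).
by move=> e; apply/(eqmodP (qrep_equiv M N))/asboolP.
Qed.

Lemma qrepr_eq M N (f : qrep M N) : qrep_eq (qrepr (qclass f)) f.
Proof. by apply/qclassP; rewrite qreprK. Qed.

Definition mor_rep M N (f : Hom M N) : qrep M N :=
  QRep f (@id_mono A M) (epi_cokernel_in C (@id_epi A M))
         (@id_epi A N) (mono_kernel_in C (@id_mono A N)).

Section Composition.
Variables (M N P : A) (g : qrep N P) (f : qrep M N).

(* For f : M' -> N/N' and g : N'' -> P/P', the pullback of M' and N'' over
   N/N' maps onto M1 = f^-1((N'' + N')/N'), the kernel of that map is
   N'' ∩ N', and g ∘ f is represented by the map M1 -> P/P1 induced by g, where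
   P1/P' = g(N'' ∩ N'). *)
Let E := pullback (qmap f) (qproj f ∘ qinc g).
Let a : Hom E (qdom f) := pb1 (qmap f) (qproj f ∘ qinc g).
Let b : Hom E (qdom g) := pb2 (qmap f) (qproj f ∘ qinc g).

Definition comp_dom : A := coker (kerm a).
Definition comp_cod : A := coker (qmap g ∘ b ∘ kerm a).

Lemma comp_inc_subproof : exists i : Hom comp_dom (qdom f), i ∘ cokerm (kerm a) = a.
Proof. exact: coker_desc (cokermP _) (proj1 (kermP a)). Qed.

Lemma comp_map_subproof : exists h : Hom comp_dom comp_cod,
  h ∘ cokerm (kerm a) = cokerm (qmap g ∘ b ∘ kerm a) ∘ qmap g ∘ b.
Proof.
apply: coker_desc (cokermP _) _.
by rewrite -(proj1 (cokermP (qmap g ∘ b ∘ kerm a))) !compmA.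
Qed.

Definition comp_inc : Hom comp_dom M := qinc f ∘ proj1_sig (cid comp_inc_subproof).
Definition comp_proj : Hom P comp_cod := cokerm (qmap g ∘ b ∘ kerm a) ∘ qproj g.
Definition comp_map : Hom comp_dom comp_cod := proj1_sig (cid comp_map_subproof).

Lemma comp_incE : comp_inc ∘ cokerm (kerm a) = qinc f ∘ a.
Proof. by rewrite /comp_inc; case: cid => i /= e; rewrite -compmA e. Qed.

Lemma comp_mapE :
  comp_map ∘ cokerm (kerm a) = cokerm (qmap g ∘ b ∘ kerm a) ∘ qmap g ∘ b.
Proof. by rewrite /comp_map; case: cid. Qed.

Lemma comp_inc_mono : is_mono comp_inc.
Proof.
apply: mono0P => W y iy.
have [W1 [e1 [x [ee1 ex]]]] := lift_epi y (coker_epi (cokermP (kerm a))).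
have ax : a ∘ x = 0.
  apply: (mono0 (@qinc_mono _ _ f)).
  by rewrite compmA -comp_incE -compmA ex compmA iy comp0m.
have [u eu] := ker_lift (kermP a) ax.
apply: (epi0 ee1).
by rewrite -ex -eu compmA (proj1 (cokermP _)) comp0m.
Qed.

Lemma comp_serre_iso_subproof : serre_iso C a.
Proof.
apply: (pullback_serre_iso (pullbackP _ _)); apply: comp_serre_iso.
  by split; [apply: qproj_ker|apply/epi_cokernel_in/qproj_epi].
by split; [apply/mono_kernel_in/qinc_mono|apply: qinc_coker].
Qed.

Lemma comp_inc_coker : cokernel_in C comp_inc.
Proof.
apply: (@cokernel_in_cancel _ C _ _ _ _ (cokerm (kerm a))).
rewrite comp_incE; apply: cokernel_in_comp; first exact: qinc_coker.
exact: (proj2 comp_serre_iso_subproof).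
Qed.

Lemma comp_proj_epi : is_epi comp_proj.
Proof. exact: comp_epi (coker_epi (cokermP _)) (@qproj_epi _ _ g). Qed.

Lemma comp_proj_ker : kernel_in C comp_proj.
Proof.
apply: kernel_in_comp (@qproj_ker _ _ g); apply: coker_kernel_in (cokermP _) _.
exact: kernel_inP (kermP a) (proj1 comp_serre_iso_subproof).
Qed.

Definition comp_rep : qrep M P :=
  QRep comp_map comp_inc_mono comp_inc_coker comp_proj_epi comp_proj_ker.

Lemma roof_comp F (s : Hom F M) (t : Hom F N) G (s' : Hom G N) (t' : Hom G P)
    (x : Hom F G) :
  is_roof f s t -> is_roof g s' t' -> s' ∘ x = t ->
  is_roof comp_rep s (t' ∘ x).
Proof.
move=> [cs [s1 [es et]]] [_ [s2 [es2 et2]]] ex; split=> //.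
have [e [[ea eb] _]] :
    exists! e : Hom F E, a ∘ e = s1 /\ b ∘ e = s2 ∘ x.
  apply: (proj2 (pullbackP _ _)).
  by rewrite -compmA (compmA (qinc g)) es2 ex et.
exists (cokerm (kerm a) ∘ e); split; rewrite /=.
  by rewrite compmA comp_incE -compmA ea.
rewrite [RHS]compmA comp_mapE -[RHS]compmA eb /comp_proj.
move: (cokerm _) => v.
by rewrite -2!(compmA v) (compmA (qproj g)) et2 -(compmA _ s2).
Qed.

End Composition.

Lemma roof_ex2 M N P (g : qrep N P) (f : qrep M N) :
  exists F (s : Hom F M) (t : Hom F N) G (s' : Hom G N) (t' : Hom G P)
    (x : Hom F G),
  [/\ is_roof f s t, is_roof g s' t' & s' ∘ x = t].
Proof.
have [E [s [t rf]]] := roof_ex f; have [G [s' [t' rg]]] := roof_ex g.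
have [F [y [x pb]]] := pullback_ex t s'.
exists F, (s ∘ y), (t ∘ y), G, s', t', x; split=> //; last by rewrite (proj1 pb).
by apply: roof_restr rf _; apply: (pullback_serre_iso pb); case: rg.
Qed.

Lemma comp_rep_eq M N P (g g' : qrep N P) (f f' : qrep M N) :
  qrep_eq g g' -> qrep_eq f f' -> qrep_eq (comp_rep g f) (comp_rep g' f').
Proof.
move=> eg ef.
have [E [s [t rf]]] := roof_ex f; have [G [s1 [t1 rg]]] := roof_ex g.
have [E' [u [cu rf']]] := qrep_eq_roof ef rf.
have [G' [w [cw rg']]] := qrep_eq_roof eg rg.
have [F [y [x pb]]] := pullback_ex (t ∘ u) (s1 ∘ w).
have cy : serre_iso C y by apply: (pullback_serre_iso pb); case: rg'.
have rfy := roof_restr (roof_restr rf cu) cy.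
have rfy' := roof_restr rf' cy.
exact: roof_eq (roof_comp rfy (roof_restr rg cw) (esym (proj1 pb)))
               (roof_comp rfy' rg' (esym (proj1 pb))).
Qed.

Lemma roof_mor M N (f : Hom M N) E (s : Hom E M) :
  serre_iso C s -> is_roof (mor_rep f) s (f ∘ s).
Proof. by move=> cs; split=> //; exists s; rewrite /= !comp1m. Qed.

Definition qid M : qhom M M := qclass (mor_rep (idm M)).

Definition qcomp M N P (G : qhom N P) (F : qhom M N) : qhom M P :=
  qclass (comp_rep (qrepr G) (qrepr F)).

Lemma qcompE M N P (g : qrep N P) (f : qrep M N) :
  qcomp (qclass g) (qclass f) = qclass (comp_rep g f).
Proof. by apply/qclassP/comp_rep_eq; apply: qrepr_eq. Qed.

Lemma qcomp1 M N (F : qhom M N) : qcomp F (qid M) = F.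
Proof.
rewrite -(qreprK F); set f := qrepr F; rewrite qcompE; apply/qclassP.
have [E [s [t rf]]] := roof_ex f.
have := roof_comp (x := idm E) (roof_mor (idm M) (proj1 rf)) rf.
by rewrite comp1m !compm1 => /(_ erefl) r; apply: roof_eq r rf.
Qed.

Lemma qcomp1l M N (F : qhom M N) : qcomp (qid N) F = F.
Proof.
rewrite -(qreprK F); set f := qrepr F; rewrite qcompE; apply/qclassP.
have [E [s [t rf]]] := roof_ex f.
have := roof_comp (x := t) rf (roof_mor (idm N) (id_serre_iso C N)).
by rewrite !comp1m => /(_ erefl) r; apply: roof_eq r rf.
Qed.

Lemma qcompA M N P R (H : qhom P R) (G : qhom N P) (F : qhom M N) :
  qcomp H (qcomp G F) = qcomp (qcomp H G) F.
Proof.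
rewrite -(qreprK F) -(qreprK G) -(qreprK H).
move: (qrepr F) (qrepr G) (qrepr H) => f g h; rewrite !qcompE; apply/qclassP.
have [G1 [s2 [t2 [H1 [s3 [t3 [z [rg rh ez]]]]]]]] := roof_ex2 h g.
have rhg := roof_comp rg rh ez.
have [E [s1 [t1 rf]]] := roof_ex f.
have [F1 [w [y pb]]] := pullback_ex t1 s2.
have rf1 : is_roof f (s1 ∘ w) (t1 ∘ w).
  by apply: roof_restr rf _; apply: (pullback_serre_iso pb); case: rg.
have ey := esym (proj1 pb).
apply: roof_eq (roof_comp rf1 rhg ey).
rewrite -compmA; apply: roof_comp (roof_comp rf1 rg ey) rh _.
by rewrite compmA ez.
Qed.

Definition quotient_category : category :=
  Category qcomp1 qcomp1l qcompA.

End Quotient.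

Section QuotientMonoidal.
Variables (A : abelian_category) (m : monoidal_data A).
Hypotheses (hm : is_monoidal m) (hb : biexact m).
Variable C : serre_subcategory A.
Hypothesis hC : two_sided_tensor_ideal m C.
Implicit Types M N X Y Z W : A.

Let abA := ab_abelian A.

Lemma tensm_split M N X Y (f : Hom M N) (g : Hom X Y) :
  tensm m f g = tensm m f (idm Y) ∘ tensm m (idm M) g.
Proof. by rewrite -(tensm_comp hm) compm1 comp1m. Qed.

Lemma ses_mono X Y (i : Hom X Y) : is_mono i -> is_ses i (cokerm i).
Proof. by move=> mi; split; [apply: mono_ker (cokermP i)|apply: cokermP]. Qed.

Lemma ses_epi X Y (p : Hom X Y) : is_epi p -> is_ses (kerm p) p.
Proof. by move=> ep; split; [apply: kermP|apply: epi_coker (kermP p)]. Qed.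

Lemma tens_mono M N X Y (f : Hom M N) (g : Hom X Y) :
  is_mono f -> is_mono g -> is_mono (tensm m f g).
Proof.
move=> /ses_mono sf /ses_mono sg; rewrite tensm_split; apply: comp_mono.
  exact: ker_mono (proj1 (proj1 (hb Y sf))).
exact: ker_mono (proj1 (proj2 (hb M sg))).
Qed.

Lemma tens_epi M N X Y (f : Hom M N) (g : Hom X Y) :
  is_epi f -> is_epi g -> is_epi (tensm m f g).
Proof.
move=> /ses_epi sf /ses_epi sg; rewrite tensm_split; apply: comp_epi.
  exact: coker_epi (proj2 (proj1 (hb Y sf))).
exact: coker_epi (proj2 (proj2 (hb M sg))).
Qed.

Lemma tens_mono_coker M N X Y (f : Hom M N) (g : Hom X Y) :
  is_mono f -> is_mono g -> cokernel_in C f -> cokernel_in C g ->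
  cokernel_in C (tensm m f g).
Proof.
move=> /ses_mono sf /ses_mono sg cf cg.
have Cf := cokernel_inP (cokermP f) cf; have Cg := cokernel_inP (cokermP g) cg.
rewrite tensm_split; apply: cokernel_in_comp.
  by do 2 eexists; split; [apply: (proj2 (proj1 (hb Y sf)))|apply: (hC _ Cf).2].
by do 2 eexists; split; [apply: (proj2 (proj2 (hb M sg)))|apply: (hC _ Cg).1].
Qed.

Lemma tens_epi_ker M N X Y (f : Hom M N) (g : Hom X Y) :
  is_epi f -> is_epi g -> kernel_in C f -> kernel_in C g ->
  kernel_in C (tensm m f g).
Proof.
move=> /ses_epi sf /ses_epi sg cf cg.
have Cf := kernel_inP (kermP f) cf; have Cg := kernel_inP (kermP g) cg.
rewrite tensm_split; apply: kernel_in_comp.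
  by do 2 eexists; split; [apply: (proj1 (proj1 (hb Y sf)))|apply: (hC _ Cf).2].
by do 2 eexists; split; [apply: (proj1 (proj2 (hb M sg)))|apply: (hC _ Cg).1].
Qed.

Lemma tens_serre_iso M N X Y (f : Hom M N) (g : Hom X Y) :
  serre_iso C f -> serre_iso C g -> serre_iso C (tensm m f g).
Proof.
move=> [kf cf] [kg cg].
have [I [e [i [ee mi ef]]]] := image_fact f.
have [J [e' [j [ee' mj eg]]]] := image_fact g.
rewrite ef in kf cf; rewrite eg in kg cg.
have ci := cokernel_in_cancel cf; have cj := cokernel_in_cancel cg.
have ke := kernel_in_cancel kf; have ke' := kernel_in_cancel kg.
rewrite ef eg (tensm_comp hm); apply: comp_serre_iso; split.
- exact: mono_kernel_in (tens_mono mi mj).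
- exact: tens_mono_coker.
- exact: tens_epi_ker.
- exact: epi_cokernel_in (tens_epi ee ee').
Qed.

Definition tens_rep M N X Y (f : qrep C M N) (g : qrep C X Y) :
    qrep C (tens m M X) (tens m N Y) :=
  QRep (tensm m (qmap f) (qmap g))
    (tens_mono (@qinc_mono _ _ _ _ f) (@qinc_mono _ _ _ _ g))
    (tens_mono_coker (@qinc_mono _ _ _ _ f) (@qinc_mono _ _ _ _ g)
       (qinc_coker f) (qinc_coker g))
    (tens_epi (@qproj_epi _ _ _ _ f) (@qproj_epi _ _ _ _ g))
    (tens_epi_ker (@qproj_epi _ _ _ _ f) (@qproj_epi _ _ _ _ g)
       (qproj_ker f) (qproj_ker g)).

Lemma roof_tens M N X Y (f : qrep C M N) (g : qrep C X Y)
    E (s : Hom E M) (t : Hom E N) F (s' : Hom F X) (t' : Hom F Y) :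
  is_roof f s t -> is_roof g s' t' ->
  is_roof (tens_rep f g) (tensm m s s') (tensm m t t').
Proof.
move=> [cs [u [eu et]]] [cs' [u' [eu' et']]].
split; first exact: tens_serre_iso.
by exists (tensm m u u'); rewrite /= -!(tensm_comp hm) eu eu' et et'.
Qed.

Lemma tens_rep_eq M N X Y (f f' : qrep C M N) (g g' : qrep C X Y) :
  qrep_eq f f' -> qrep_eq g g' -> qrep_eq (tens_rep f g) (tens_rep f' g').
Proof.
move=> ef eg.
have [E [s [t rf]]] := roof_ex f; have [G [s1 [t1 rg]]] := roof_ex g.
have [E' [u [cu rf']]] := qrep_eq_roof ef rf.
have [G' [w [cw rg']]] := qrep_eq_roof eg rg.
apply: roof_eq (roof_tens rf' rg').
exact: roof_tens (roof_restr rf cu) (roof_restr rg cw).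
Qed.

Definition qtens M N X Y (F : qhom C M N) (G : qhom C X Y) :
    qhom C (tens m M X) (tens m N Y) :=
  qclass (tens_rep (qrepr F) (qrepr G)).

Lemma qtensE M N X Y (f : qrep C M N) (g : qrep C X Y) :
  qtens (qclass f) (qclass g) = qclass (tens_rep f g).
Proof. by apply/qclassP/tens_rep_eq; apply: qrepr_eq. Qed.

Definition quotient_monoidal : monoidal_data (quotient_category C) :=
  @MonoidalData (quotient_category C) (tens m) qtens (munit m)
    (fun X Y Z => qclass (mor_rep C (assoc m X Y Z)))
    (fun X => qclass (mor_rep C (lunit m X)))
    (fun X => qclass (mor_rep C (runit m X))).

End QuotientMonoidal.

(* Main.v *)
Require Import Defs.
From mathcomp Require Import ssreflect ssrfun ssrbool.

(** A morphism of A/C is handled through roofs M <- E -> N of A whose left leg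
    has kernel and cokernel in C: such a roof determines the morphism
    ([roof_eq]).  Roofs compose along any lift of the right leg of the first
    through the left leg of the second ([roof_comp]), and can be tensored
    legwise because the tensor product is biexact and C is a tensor ideal
    ([roof_tens]).  Hence an equation between morphisms of A/C holds as soon as
    both sides are given by one common roof.

    Two facts follow.  First, the canonical functor T : A -> A/C preserves
    identities, composition and tensor products ([canmor_id], [canmor_comp],
    [canmor_tens]).  The invertibility of the constraints, the pentagon and the
    triangle involve only morphisms in the image of T, so they are the images
    of the same assertions in A.  Second, a commutative ladder of A between two
    roofs yields a commutative square of A/C ([roof_square]); for the
    naturality of a constraint, its component at the middle objects of the
    roofs is the middle column of such a ladder, and naturality in A at the left
    and at the right legs makes the two halves commute.  Functoriality
    of the tensor product of morphisms is the interchange law of A applied to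
    the legs of tensored roofs. *)

Set Implicit Arguments.
Unset Strict Implicit.
Unset Printing Implicit Defensive.

Local Open Scope cat_scope.

Section CanonicalFunctor.
Variables (A : abelian_category) (C : serre_subcategory A).
Implicit Types M N P : A.

Definition canmor M N (f : Hom M N) : qhom C M N := qclass (mor_rep C f).

Lemma canmor_id M : canmor (idm M) = qid C M.
Proof. by []. Qed.

Lemma roof_canmor M N (f : Hom M N) : is_roof (mor_rep C f) (idm M) f.
Proof. by have := roof_mor f (id_serre_iso C M); rewrite compm1. Qed.

Lemma canmor_comp M N P (g : Hom N P) (f : Hom M N) :
  canmor (g ∘ f) = qcomp (canmor g) (canmor f).
Proof.
rewrite /canmor qcompE; apply/qclassP; apply: roof_eq (roof_canmor _) _.
by apply: roof_comp (roof_canmor f) (roof_canmor g) _; rewrite comp1m.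
Qed.

Lemma canmor_iso M N (f : Hom M N) :
  is_iso f -> @is_iso (quotient_category C) M N (canmor f).
Proof.
move=> [g [gf fg]]; exists (canmor g).
by rewrite /= -!canmor_comp gf fg.
Qed.

(** The middle column w of the ladder turns both composites into the roof
    M <- E -> N' with legs s and n ∘ t = t' ∘ w. *)
Lemma roof_square M N M' N' (f : qrep C M N) (f' : qrep C M' N')
    (m : Hom M M') (n : Hom N N')
    E (s : Hom E M) (t : Hom E N) E' (s' : Hom E' M') (t' : Hom E' N')
    (w : Hom E E') :
  is_roof f s t -> is_roof f' s' t' -> m ∘ s = s' ∘ w -> n ∘ t = t' ∘ w ->
  qcomp (canmor n) (qclass f) = qcomp (qclass f') (canmor m).
Proof.
move=> rf rf' es et; rewrite /canmor !qcompE; apply/qclassP.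
have rnf : is_roof (comp_rep (mor_rep C n) f) s (n ∘ t).
  by apply: roof_comp rf (roof_canmor n) _; rewrite comp1m.
apply: roof_eq rnf _; rewrite et.
by apply: roof_comp (roof_mor m (proj1 rf)) rf' _; rewrite es.
Qed.

End CanonicalFunctor.

Section QuotientTensor.
Variables (A : abelian_category) (m : monoidal_data A).
Hypotheses (hm : is_monoidal m) (hb : biexact m).
Variable C : serre_subcategory A.
Hypothesis hC : two_sided_tensor_ideal m C.
Implicit Types M N P X Y Z : A.

Let qt := quotient_monoidal hm hb hC.

Lemma canmor_tens M N X Y (f : Hom M N) (g : Hom X Y) :
  tensm qt (canmor C f) (canmor C g) = canmor C (tensm m f g).
Proof.
rewrite /= /canmor qtensE; apply/qclassP.
apply: roof_eq (roof_tens hm hb hC (roof_canmor C f) (roof_canmor C g)) _.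
by rewrite (tensm1 hm); apply: roof_canmor.
Qed.

(** If x and y lift the right legs of the first roofs through the left legs of
    the second ones, then x ⊗ y does the same for the tensored roofs, so
    composing and tensoring roofs commute by the interchange law of A. *)
Lemma qtens_comp M N P X Y Z (f' : qrep C N P) (f : qrep C M N)
    (g' : qrep C Y Z) (g : qrep C X Y) :
  tensm qt (qcomp (qclass f') (qclass f)) (qcomp (qclass g') (qclass g)) =
  qcomp (tensm qt (qclass f') (qclass g')) (tensm qt (qclass f) (qclass g)).
Proof.
rewrite /= 2!qcompE !qtensE qcompE; apply/qclassP.
have [F [s [t [G [s' [t' [x [rf rf' ex]]]]]]]] := roof_ex2 f' f.
have [H [u [v [K [u' [v' [y [rg rg' ey]]]]]]]] := roof_ex2 g' g.
apply: roof_eq (roof_tens hm hb hC (roof_comp rf rf' ex) (roof_comp rg rg' ey)) _.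
rewrite (tensm_comp hm).
apply: roof_comp (roof_tens hm hb hC rf rg) (roof_tens hm hb hC rf' rg') _.
by rewrite -(tensm_comp hm) ex ey.
Qed.

End QuotientTensor.

Theorem proposition4p8 (A : abelian_category) (m : monoidal_data A)
    (hm : is_monoidal m) (hb : biexact m)
    (C : serre_subcategory A) (hC : two_sided_tensor_ideal m C) :
  is_monoidal (quotient_monoidal hm hb hC).
Proof.
pose qt := quotient_monoidal hm hb hC.
have qid_canmor (X : A) :
  @idm (quotient_category C) X = canmor C (idm X) by [].
have canT := canmor_tens hm hb hC.
split.
- by move=> X Y; rewrite !qid_canmor canT (tensm1 hm).
- move=> M N P X Y Z F' F G' G.
  rewrite -(qreprK F') -(qreprK F) -(qreprK G') -(qreprK G).
  exact: qtens_comp.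
- by move=> X Y Z; apply/canmor_iso/(assoc_iso hm).
- by move=> X; apply/canmor_iso/(lunit_iso hm).
- by move=> X; apply/canmor_iso/(runit_iso hm).
- move=> X X' Y Y' Z Z' F G H.
  rewrite -(qreprK F) -(qreprK G) -(qreprK H) /= !qtensE.
  have [D [s [t rf]]] := roof_ex (qrepr F).
  have [E [u [v rg]]] := roof_ex (qrepr G).
  have [K [x [y rh]]] := roof_ex (qrepr H).
  apply: (roof_square (w := assoc m D E K)
            (roof_tens hm hb hC (roof_tens hm hb hC rf rg) rh)
            (roof_tens hm hb hC rf (roof_tens hm hb hC rg rh)));
    exact: assoc_natural.
- move=> X X' F; rewrite qid_canmor -(qreprK F) /= qtensE.
  have [E [s [t rf]]] := roof_ex (qrepr F).
  apply: (roof_square (w := lunit m E)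
            (roof_tens hm hb hC (roof_canmor C (idm (munit m))) rf) rf);
    exact: lunit_natural.
- move=> X X' F; rewrite qid_canmor -(qreprK F) /= qtensE.
  have [E [s [t rf]]] := roof_ex (qrepr F).
  apply: (roof_square (w := runit m E)
            (roof_tens hm hb hC rf (roof_canmor C (idm (munit m)))) rf);
    exact: runit_natural.
- move=> W X Y Z; rewrite !qid_canmor !canT.
  by rewrite /= -!canmor_comp (pentagon hm).
- move=> X Y; rewrite !qid_canmor !canT.
  by rewrite /= -!canmor_comp (triangle hm).
Qed.
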